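(* There exist four-dimensional simply connected, unimodular and non-nilpotent solvable Lie groups which have no lattices.
   Context: A lattice of a Lie group $G$ is a discrete subgroup $\Gamma$ of $G$ such that $\Gamma\backslash G$ is compact. *)

(* Defs.v *)
From HB Require Import structures.
From mathcomp Require Import all_boot all_order all_algebra generic_quotient.
From mathcomp Require Import all_classical all_reals all_analysis.
Import numFieldNormedType.Exports.

Set Implicit Arguments.
Unset Strict Implicit.
Unset Printing Implicit Defensive.

Import Order.TTheory GRing.Theory Num.Theory.
Local Open Scope classical_set_scope.
Local Open Scope ring_scope.

(* [Ck k U f]: f is of class C^k on U. It is meant for U open in a
   finite-dimensional space, so that only the values of f on U matter. *)
Fixpoint Ck (R : realType) (V W : normedModType R) (k : nat) (U : set V)
    (f : V -> W) : Prop :=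
  match k with
  | 0 => forall x, U x -> {for x, continuous f}
  | k'.+1 => (forall x, U x -> differentiable f x) /\
             forall v : V, Ck k' U (fun x => 'D_v f x)
  end.

Definition smooth_on (R : realType) (V W : normedModType R) (U : set V)
  (f : V -> W) : Prop := forall k, Ck k U f.

(* A homeomorphism from an open subset of M onto an open subset of R^n. Both
   maps are total functions; their values outside [chart_dom] and [chart_cod]
   are irrelevant. *)
Record chart (R : realType) (n : nat) (M : topologicalType) := Chart {
  chart_dom : set M;
  chart_cod : set 'rV[R]_n;
  chart_map :> M -> 'rV[R]_n;
  chart_inv : 'rV[R]_n -> M;
  chart_dom_open : open chart_dom;
  chart_cod_open : open chart_cod;
  chart_map_cod : forall x, chart_dom x -> chart_cod (chart_map x);
  chart_inv_dom : forall u, chart_cod u -> chart_dom (chart_inv u);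
  chart_mapK : forall x, chart_dom x -> chart_inv (chart_map x) = x;
  chart_invK : forall u, chart_cod u -> chart_map (chart_inv u) = u;
  chart_map_continuous : forall x, chart_dom x -> {for x, continuous chart_map};
  chart_inv_continuous : forall u, chart_cod u -> {for u, continuous chart_inv}
}.

HB.mixin Record isSmoothManifold (R : realType) (n : nat) M
    of PointedTopological M := {
  manifold_hausdorff : hausdorff_space M;
  manifold_second_countable : @second_countable M;
  atlas : set (chart R n M);
  atlas_cover : forall x : M, exists2 a, atlas a & chart_dom a x;
  atlas_compatible : forall a b, atlas a -> atlas b ->
    smooth_on (chart_cod a `&` chart_inv a @^-1` chart_dom b)
      (b \o chart_inv a)
}.

#[short(type="smoothManifoldType")]
HB.structure Definition SmoothManifold (R : realType) (n : nat) :=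
  {M of isSmoothManifold R n M & PointedTopological M}.

Definition smooth_map (R : realType) (m n : nat) (M : smoothManifoldType R m)
    (N : smoothManifoldType R n) (f : M -> N) : Prop :=
  continuous f /\
  forall (a : chart R m M) (b : chart R n N), atlas a -> atlas b ->
    smooth_on (chart_cod a `&` (f \o chart_inv a) @^-1` chart_dom b)
      (b \o f \o chart_inv a).

(* Smoothness of a map from the product manifold M1 * M2, read in the product
   charts a1 * a2, which form an atlas of M1 * M2. *)
Definition smooth_map2 (R : realType) (m1 m2 n : nat)
    (M1 : smoothManifoldType R m1) (M2 : smoothManifoldType R m2)
    (N : smoothManifoldType R n) (f : M1 * M2 -> N) : Prop :=
  continuous f /\
  forall (a1 : chart R m1 M1) (a2 : chart R m2 M2) (b : chart R n N),
    atlas a1 -> atlas a2 -> atlas b ->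
    let f12 := fun u : 'rV[R]_m1 * 'rV[R]_m2 =>
      f (chart_inv a1 u.1, chart_inv a2 u.2) in
    smooth_on ((chart_cod a1 `*` chart_cod a2) `&` f12 @^-1` chart_dom b)
      (b \o f12).

HB.mixin Record isLieGroup (R : realType) (n : nat) G
    of SmoothManifold R n G & Group G := {
  mulg_smooth : smooth_map2 (fun x : G * G => (x.1 * x.2)%g : G);
  invg_smooth : smooth_map (fun x : G => (x^-1)%g : G)
}.

#[short(type="lieGroupType")]
HB.structure Definition LieGroup (R : realType) (n : nat) :=
  {G of isLieGroup R n G & SmoothManifold R n G & Group G}.

Definition path_connected (R : realType) (T : topologicalType) : Prop :=
  forall x y : T, exists f : R -> T,
    [/\ {within `[0, 1], continuous f}, f 0 = x & f 1 = y].

(* Path-connected, and every loop is homotopic to a constant loop through loops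
   with the same base point. *)
Definition simply_connected (R : realType) (T : topologicalType) : Prop :=
  path_connected R T /\
  forall f : R -> T, {within `[0, 1], continuous f} -> f 0 = f 1 ->
    exists H : R * R -> T,
      [/\ {within `[0, 1] `*` `[0, 1], continuous H},
          forall s, 0 <= s <= 1 -> H (s, 0) = f s,
          forall s, 0 <= s <= 1 -> H (s, 1) = f 0 &
          forall t, 0 <= t <= 1 -> H (0, t) = f 0 /\ H (1, t) = f 0].

Section abstract_group.
Context {G : groupType}.
Implicit Types A B : set G.

Definition gen A : set G :=
  [set x | forall H : groupClosed G, A `<=` [set` H] -> x \in H].

Definition commutator A B : set G :=
  gen [set [~ x, y]%g | x in A & y in B].

Definition derived_series (k : nat) : set G :=
  iter k (fun A => commutator A A) [set: G].

Definition lower_central_series (k : nat) : set G :=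
  iter k (fun A => commutator A [set: G]) [set: G].

End abstract_group.

Definition solvable_group (G : groupType) : Prop :=
  exists k, @derived_series G k = [set 1%g].

Definition nilpotent_group (G : groupType) : Prop :=
  exists k, @lower_central_series G k = [set 1%g].

Section lie_group.
Context {R : realType} {n : nat} (G : lieGroupType R n).

Local Notation borel := (g_sigma_algebraType (@open G)).

Implicit Type mu : {measure set borel -> \bar R}.

Definition left_invariant mu : Prop := forall (g : G) (A : set borel),
  measurable A -> mu [set (g * x)%g | x in (A : set G)] = mu A.

Definition right_invariant mu : Prop := forall (g : G) (A : set borel),
  measurable A -> mu [set (x * g)%g | x in (A : set G)] = mu A.

(* A locally finite Borel measure on a manifold is automatically regular. *)
Definition left_haar_measure mu : Prop :=
  [/\ left_invariant mu,
      forall K : set G, compact K -> (mu K < +oo)%E &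
      forall U : set G, open U -> U !=set0 -> (0 < mu U)%E].

(* The left Haar measure, which is unique up to a positive factor, is also
   right-invariant. *)
Definition unimodular : Prop :=
  exists mu : {measure set borel -> \bar R},
    left_haar_measure mu /\ right_invariant mu.

End lie_group.

Section lattice.
Local Open Scope group_scope.
Local Open Scope quotient_scope.
Context {R : realType} {n : nat} {G : lieGroupType R n}
  (Gamma : groupClosed G).

(* Gamma x = Gamma y *)
Definition same_coset : rel G := fun x y => x / y \in Gamma.

Lemma same_coset_equiv : equiv_class_of same_coset.
Proof.
split=> [x|x y|y x z xy yz]; first by rewrite /same_coset mulgV gpred1.
- exact: gpredFC.
- by rewrite /same_coset -(mulgVK y x) -mulgA; exact: gpredM.
Qed.

Canonical same_coset_equiv_rel := EquivRelPack same_coset_equiv.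

(* Gamma\G *)
Definition coset_space : topologicalType :=
  quotient_topology {eq_quot same_coset}.

Definition is_lattice : Prop :=
  [set` Gamma] `<=` isolated [set` Gamma] /\ compact [set: coset_space].

End lattice.

(* Main.v *)
From HB Require Import structures.
Require Import Defs.
From mathcomp Require Import all_boot all_order all_algebra generic_quotient.
From mathcomp Require Import all_classical all_reals all_analysis.
From mathcomp Require Import measurable_realfun ring lra.
Import numFieldNormedType.Exports.

Set Implicit Arguments.
Unset Strict Implicit.
Unset Printing Implicit Defensive.

Import Order.TTheory GRing.Theory Num.Theory.
Local Open Scope classical_set_scope.
Local Open Scope quotient_scope.
Local Open Scope ring_scope.

(** The group is G = R |x R^3, where t acts on R^3 by
    diag (exp t, exp t, exp (-2 t)); it is known as the geometry Sol^4_0. As a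
    manifold it is R^4, hence simply connected; the action is linear of
    determinant 1, hence Lebesgue measure is bi-invariant; the commutators lie
    in the abelian factor R^3, hence G is solvable; a commutator with t = - ln 2
    fixes the first eigenline, hence the lower central series never vanishes.

    Suppose that Gamma is a lattice. A Gamma-invariant continuous function
    descends to the compact quotient and is bounded ([invariant_bounded]). The
    coordinate t is unbounded, so Gamma contains some u with t(u) > 0
    ([lattice_shift]). Let L be the intersection of Gamma with R^3: a discrete
    subgroup, invariant under the action of t(u). The general theory would show
    that L spans R^3, so that diag (mu, mu, mu^-2), with mu = exp t(u), is
    conjugate to an integer matrix, and a double eigenvalue other than 1 or -1
    is impossible. There is a shorter way: already L = 0 ([dil_discrete]).
    Indeed a vector of L in one of the two eigenspaces is contracted to 0 by the
    positive or by the negative powers of the action. Any other vector spans,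
    with its images, a plane on which the action has determinant mu^-1 <> 1,
    whereas an automorphism of a lattice of the plane preserves areas;
    concretely, Dirichlet approximation gives integral combinations of two
    consecutive images that are nonzero and arbitrarily small.

    As L = 0 contains all commutators of u with Gamma, the group Gamma
    centralizes u, hence fixes the fixed point c of u in the affine action of G
    on R^3. Then (v_1 - c_1) exp (- v_0) is an unbounded Gamma-invariant
    function, a contradiction. *)

(** * Smoothness of exponential polynomials *)

Section exponential_polynomials.
Context {R : realType} {V : normedModType R}.

(** Closed under directional derivatives, so that all its members are smooth;
    it contains the coordinates of the group law. *)
Inductive exp_poly : (V -> R) -> Prop :=
| exp_poly_linear (l : {linear V -> R}) : continuous l -> exp_poly l
| exp_poly_cst c : exp_poly (cst c)
| exp_polyD f g : exp_poly f -> exp_poly g -> exp_poly (f + g)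
| exp_polyM f g : exp_poly f -> exp_poly g -> exp_poly (f * g)
| exp_poly_exp f : exp_poly f -> exp_poly (expR \o f).

Lemma differentiable_expR (x : R) : differentiable (@expR R) x.
Proof. by apply/derivable1_diffP; exact: derivable_expR. Qed.

Lemma exp_poly_differentiable f x : exp_poly f -> differentiable f x.
Proof.
elim=> {f} [l lc|c|f g _ df _ dg|f g _ df _ dg|f _ df].
- exact: linear_differentiable.
- exact: differentiable_cst.
- exact: differentiableD.
- exact: differentiableM.
- by apply: differentiable_comp => //; exact: differentiable_expR.
Qed.

Lemma exp_poly_derive f v : exp_poly f -> exp_poly (fun x => 'D_v f x).
Proof.
elim=> {f} [l lc|c|f g ef Df eg Dg|f g ef Df eg Dg|f ef Df].
- rewrite (_ : (fun _ => _) = cst (l v)); first exact: exp_poly_cst.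
  apply/funext => x /=; rewrite deriveE ?diff_lin//.
  exact: linear_differentiable.
- rewrite (_ : (fun _ => _) = cst 0); first exact: exp_poly_cst.
  by apply/funext => x /=; rewrite derive_cst.
- rewrite (_ : (fun _ => _) = 'D_v f + 'D_v g); first exact: exp_polyD.
  apply/funext => x; rewrite deriveD//;
    by apply: diff_derivable; exact: exp_poly_differentiable.
- rewrite (_ : (fun _ => _) = f * 'D_v g + g * 'D_v f).
    by apply: exp_polyD; exact: exp_polyM.
  apply/funext => x; rewrite deriveM//;
    by apply: diff_derivable; exact: exp_poly_differentiable.
- rewrite (_ : (fun _ => _) = (expR \o f) * 'D_v f).
    by apply: exp_polyM => //; exact: exp_poly_exp.
  have df x : differentiable f x by exact: exp_poly_differentiable.
  have de x : differentiable (@expR R) (f x) by exact: differentiable_expR.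
  apply/funext => x; rewrite -[RHS]/(expR (f x) * 'D_v f x).
  rewrite (deriveE _ (differentiable_comp (df x) (de x))) (deriveE _ (df x)).
  have -> : 'd (expR \o f) x v = 'd expR (f x) ('d f x v).
    by rewrite (diff_comp (df x) (de x)).
  have := linearZ_LR ('d expR (f x)) ('d f x v) 1.
  have d1 : 'd expR (f x) 1 = expR (f x).
    rewrite -(deriveE _ (de x)).
    exact: (@derive_val _ _ _ _ _ _ _ (is_derive_expR (f x))).
  rewrite d1 => expRZ.
  by rewrite mulrC -[RHS]expRZ -[_ *: 1]/(_ * 1) mulr1.
Qed.

Lemma row_exp_poly_differentiable n (f : V -> 'rV[R]_n) x :
  (forall i, exp_poly (fun y => f y ord0 i)) -> differentiable f x.
Proof.
move=> ef.
rewrite (_ : f = \sum_(i < n) (fun y => f y ord0 i *: 'e_i)).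
  apply: differentiable_sum => i; apply: differentiableZl.
  exact: exp_poly_differentiable (ef i).
by apply/funext => y; rewrite fct_sumE {1}[f y]row_sum_delta.
Qed.

(** Directional derivatives are computed coordinatewise and remain exponential
    polynomials, so the recursion defining smoothness never leaves the class. *)
Lemma row_exp_poly_smooth n (U : set V) (f : V -> 'rV[R]_n) :
  (forall i, exp_poly (fun y => f y ord0 i)) -> smooth_on U f.
Proof.
move=> + k; elim: k f => [|k IHk] f ef /=.
  move=> x _; apply: differentiable_continuous.
  exact: row_exp_poly_differentiable.
split=> [x _|v]; first exact: row_exp_poly_differentiable.
apply: IHk => i.
rewrite (_ : (fun _ => _) = (fun y => 'D_v (fun z => f z ord0 i) y)).
  exact: exp_poly_derive.
apply/funext => y; rewrite derive_mx ?mxE//.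
by apply: diff_derivable; exact: row_exp_poly_differentiable.
Qed.

End exponential_polynomials.

(** * Row vectors as a manifold *)

Section rational_balls.
Context {R : realType} {n : nat}.

Definition rat_ball (p : 'rV[rat]_n * nat) : set 'rV[R]_n :=
  ball (map_mx ratr p.1 : 'rV[R]_n) p.2.+1%:R^-1.

Lemma rat_ball_basis : basis (range rat_ball).
Proof.
split=> [_ [p _ <-]|x A /nbhs_ballP[e e0 xeA]]; first exact: ball_open.
have e20 : 0 < e / 2 by rewrite divr_gt0.
have [m me] : exists m : nat, m.+1%:R^-1 < e / 2.
  have [m] := ltr_add_invr e20.
  by rewrite add0r => me; exists m.
have /choice[q qx] : forall i, exists q : rat,
    ball (x ord0 i) m.+1%:R^-1 (ratr q : R).
  move=> i.
  have xm : x ord0 i < x ord0 i + m.+1%:R^-1 by rewrite ltrDl invr_gt0.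
  have [q] := rat_in_itvoo xm; rewrite in_itv/= => /andP[xq qx].
  exists q; rewrite /ball/= ltr_distlC qx andbT.
  by rewrite (lt_trans _ xq)// gtrBl invr_gt0.
pose p : 'rV[rat]_n := \row_i q i.
exists (rat_ball (p, m)).
  split; first by exists (p, m).
  split=> [|i j]; first by rewrite invr_gt0.
  by rewrite !mxE (ord1 i); apply: ball_sym.
apply: subset_trans xeA => y [_ py]; split=> // i j.
have := py i j; rewrite !mxE !(ord1 i) => pyj.
rewrite (splitr e).
exact: ball_triangle (le_ball (ltW me) (qx j)) (le_ball (ltW me) pyj).
Qed.

Lemma row_second_countable : @second_countable 'rV[R]_n.
Proof.
exists (range rat_ball); last exact: rat_ball_basis.
exact/(sub_countable (card_image_le _ _))/countableP.
Qed.

End rational_balls.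

Section identity_chart.
Variables (R : realType) (n : nat).

Definition row_chart : chart R n 'rV[R]_n :=
  @Chart R n 'rV[R]_n setT setT id id openT openT
    (fun _ => id) (fun _ => id) (fun _ _ => erefl) (fun _ _ => erefl)
    (fun _ _ => cvg_id) (fun _ _ => cvg_id).

End identity_chart.

(** * The Lie group *)

Section sol_lie_group.
Variable R : realType.

(** The eigenvalues of the derivation defining the group. The weight 0 of the
    coordinate t makes the group law uniform in the four coordinates; the sum
    of the weights is 0. *)
Definition weight (i : 'I_4) : R := [:: 0; 1; 1; -2]`_i.

Definition sol4 : Type := 'rV[R]_4.

HB.instance Definition _ := PointedTopological.copy sol4 'rV[R]_4.

Implicit Types u v : sol4.

Definition sol_mul u v : sol4 :=
  \row_i (u ord0 i + expR (weight i * u ord0 ord0) * v ord0 i).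

Definition sol_inv u : sol4 :=
  \row_i (- (expR (- (weight i * u ord0 ord0)) * u ord0 i)).

Definition sol_one : sol4 := 0 : 'rV[R]_4.

Lemma weight0 : weight ord0 = 0. Proof. by []. Qed.

Lemma sol_mulA : associative sol_mul.
Proof.
move=> u v w; apply/rowP => i.
by rewrite !mxE weight0 !mul0r expR0 !mul1r !mulrDr expRD !addrA !mulrA.
Qed.

Lemma sol_mul1g : left_id sol_one sol_mul.
Proof. by move=> u; apply/rowP => i; rewrite !mxE mulr0 expR0 mul1r add0r. Qed.

Lemma sol_mulg1 : right_id sol_one sol_mul.
Proof. by move=> u; apply/rowP => i; rewrite !mxE mulr0 addr0. Qed.

Lemma sol_mulVg : left_inverse sol_one sol_inv sol_mul.
Proof.
move=> u; apply/rowP => i.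
by rewrite !mxE weight0 mul0r oppr0 expR0 mul1r mulrN addNr.
Qed.

Lemma sol_mulgV : right_inverse sol_one sol_inv sol_mul.
Proof.
move=> u; apply/rowP => i.
by rewrite !mxE mulrN mulrA expRxMexpNx_1 mul1r subrr.
Qed.

HB.instance Definition _ :=
  isGroup.Build sol4 sol_mulA sol_mul1g sol_mulg1 sol_mulVg sol_mulgV.

Lemma sol_hausdorff : hausdorff_space sol4.
Proof. exact: (@norm_hausdorff R 'rV[R]_4). Qed.

Definition coord_lin n (i : 'I_n) (u : 'rV[R]_n) : R := u ord0 i.

Lemma coord_lin_linear n (i : 'I_n) : linear (coord_lin i).
Proof. by move=> a u v; rewrite /coord_lin !mxE. Qed.

HB.instance Definition _ n (i : 'I_n) :=
  GRing.isLinear.Build R 'rV[R]_n R _ (coord_lin i) (coord_lin_linear i).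

Lemma exp_poly_coord n (i : 'I_n) : exp_poly (fun u : 'rV[R]_n => u ord0 i).
Proof.
apply: (@exp_poly_linear _ _ (coord_lin i)).
exact: coord_continuous.
Qed.

Lemma exp_poly_coord1 m n (i : 'I_m) :
  exp_poly (fun u : 'rV[R]_m * 'rV[R]_n => u.1 ord0 i).
Proof.
apply: (@exp_poly_linear _ _ (coord_lin i \o fst)).
by move=> u; apply: continuous_comp; [exact: cvg_fst|exact: coord_continuous].
Qed.

Lemma exp_poly_coord2 m n (i : 'I_n) :
  exp_poly (fun u : 'rV[R]_m * 'rV[R]_n => u.2 ord0 i).
Proof.
apply: (@exp_poly_linear _ _ (coord_lin i \o snd)).
by move=> u; apply: continuous_comp; [exact: cvg_snd|exact: coord_continuous].
Qed.

Lemma sol_atlas_cover (x : sol4) :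
  exists2 a : chart R 4 sol4, [set row_chart R 4] a & chart_dom a x.
Proof. by exists (row_chart R 4). Qed.

Lemma sol_atlas_compatible (a b : chart R 4 sol4) :
  [set row_chart R 4] a -> [set row_chart R 4] b ->
  smooth_on (chart_cod a `&` chart_inv a @^-1` chart_dom b) (b \o chart_inv a).
Proof.
by move=> -> ->; apply: row_exp_poly_smooth => i; exact: exp_poly_coord.
Qed.

HB.instance Definition _ := @isSmoothManifold.Build R 4 sol4 sol_hausdorff
  (@row_second_countable R 4) [set row_chart R 4]
  sol_atlas_cover sol_atlas_compatible.

Lemma exp_poly_mul (i : 'I_4) :
  exp_poly (fun u : 'rV[R]_4 * 'rV[R]_4 => sol_mul u.1 u.2 ord0 i).
Proof.
pose f (u : 'rV[R]_4 * 'rV[R]_4) : R := u.1 ord0 i.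
pose g (u : 'rV[R]_4 * 'rV[R]_4) : R := u.1 ord0 ord0.
pose h (u : 'rV[R]_4 * 'rV[R]_4) : R := u.2 ord0 i.
rewrite (_ : (fun _ => _) = f + (expR \o (cst (weight i) * g)) * h).
  apply: exp_polyD; first exact: exp_poly_coord1.
  apply: exp_polyM; last exact: exp_poly_coord2.
  apply: exp_poly_exp; apply: exp_polyM; first exact: exp_poly_cst.
  exact: exp_poly_coord1.
by apply/funext => u; rewrite mxE.
Qed.

Lemma exp_poly_inv (i : 'I_4) :
  exp_poly (fun u : 'rV[R]_4 => sol_inv u ord0 i).
Proof.
pose f (u : 'rV[R]_4) : R := u ord0 i.
pose g (u : 'rV[R]_4) : R := u ord0 ord0.
rewrite (_ : (fun _ => _) = cst (-1) * ((expR \o (cst (- weight i) * g)) * f)).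
  apply: exp_polyM; first exact: exp_poly_cst.
  apply: exp_polyM; last exact: exp_poly_coord.
  apply: exp_poly_exp; apply: exp_polyM; first exact: exp_poly_cst.
  exact: exp_poly_coord.
apply/funext => u.
rewrite mxE -[RHS]/(-1 * (expR (- weight i * u ord0 ord0) * u ord0 i)).
by rewrite mulN1r mulNr.
Qed.

Lemma sol_mul_smooth :
  smooth_map2 (fun x : sol4 * sol4 => (x.1 * x.2)%g : sol4).
Proof.
split=> [u|a1 a2 b -> -> -> /=].
  apply: (@differentiable_continuous _ ('rV[R]_4 * 'rV[R]_4)%type 'rV[R]_4).
  by apply: row_exp_poly_differentiable => i; exact: exp_poly_mul.
by apply: row_exp_poly_smooth => i; exact: exp_poly_mul.
Qed.

Lemma sol_inv_smooth : smooth_map (fun x : sol4 => (x^-1)%g : sol4).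
Proof.
split=> [u|a b -> -> /=].
  apply: (@differentiable_continuous _ 'rV[R]_4 'rV[R]_4).
  by apply: row_exp_poly_differentiable => i; exact: exp_poly_inv.
by apply: row_exp_poly_smooth => i; exact: exp_poly_inv.
Qed.

HB.instance Definition _ :=
  isLieGroup.Build R 4 sol4 sol_mul_smooth sol_inv_smooth.

End sol_lie_group.

(** * Simple connectedness, solvability and non-nilpotence *)

(** The homotopy contracts along segments to the base point. *)
Lemma normed_simply_connected (R : realType) (V : normedModType R) :
  simply_connected R V.
Proof.
split=> [x y|f fc f01].
  exists (fun t => x + t *: (y - x)); split.
  - apply: continuous_subspaceT => t; apply: cvgD; first exact: cvg_cst.
    by apply: cvgZr_tmp; exact: cvg_id.
  - by rewrite scale0r addr0.
  - by rewrite scale1r addrC subrK.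
exists (fun p => (1 - p.2) *: f p.1 + p.2 *: f 0); split=> [|s _|s _|t _] /=.
- apply/subspace_continuousP => -[s t] [/= s01 t01].
  have cvg2 : (fun p : R * R => p.2) @
      within (`[0, 1] `*` `[0, 1]) (nbhs (s, t)) --> t.
    by apply: cvg_within_filter; exact: cvg_snd.
  have cvg1 : (fun p : R * R => f p.1) @
      within (`[0, 1] `*` `[0, 1]) (nbhs (s, t)) --> f s.
    move/subspace_continuousP : fc => /(_ s s01) fs.
    apply: cvg_comp fs => P sP.
    have : nbhs (s, t) [set p : R * R | `[0, 1]%classic p.1 -> P p.1].
      exact: (@cvg_fst _ _ (nbhs s) (nbhs t) _ _ sP).
    by apply: filterS => -[a b] /= aP [a01 _]; exact: aP.
  apply: cvgD; last by apply: cvgZr_tmp.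
  by apply: cvgZ => //; apply: cvgB => //; exact: cvg_cst.
- by rewrite subr0 scale1r scale0r addr0.
- by rewrite subrr scale0r add0r scale1r.
- by rewrite -f01 -scalerDl subrK scale1r.
Qed.

Lemma gen_min (G : groupType) (A : set G) (S : {pred G}) :
  group_closed S -> A `<=` [set` S] -> gen A `<=` [set` S].
Proof.
move=> HS AS x; pose H := HB.pack_for (groupClosed G) S
  (isInvClosed.Build G S (group_closedV HS)) (isMul1Closed.Build G S HS.1)
  (isMulClosed.Build G S (group_closedM HS)).
by move=> /(_ H); exact.
Qed.

Section sol_series.
Variable R : realType.
Local Notation G := (sol4 R).
Implicit Types u v : G.

Lemma sol_simply_connected : simply_connected R G.
Proof. exact: (@normed_simply_connected R 'rV[R]_4). Qed.

Lemma sol_mulE u v i :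
  (u * v)%g ord0 i = u ord0 i + expR (weight R i * u ord0 ord0) * v ord0 i.
Proof. by rewrite mxE. Qed.

Lemma sol_mul0 u v : (u * v)%g ord0 ord0 = u ord0 ord0 + v ord0 ord0.
Proof. by rewrite sol_mulE weight0 mul0r expR0 mul1r. Qed.

Lemma sol_invE u i :
  (u^-1)%g ord0 i = - (expR (- (weight R i * u ord0 ord0)) * u ord0 i).
Proof. by rewrite mxE. Qed.

Lemma sol_inv0 u : (u^-1)%g ord0 ord0 = - u ord0 ord0.
Proof. by rewrite sol_invE weight0 mul0r oppr0 expR0 mul1r. Qed.

Lemma sol_oneE i : (1%g : G) ord0 i = 0.
Proof. by rewrite mxE. Qed.

(** In coordinate i, the affine action of u has the fixed point
    u_i / (1 - exp (k_i u_0)); the second factor compares those of u and v. *)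
Lemma sol_commE u v i :
  [~ u, v]%g ord0 i =
  expR (- (weight R i * (u ord0 ord0 + v ord0 ord0))) *
  ((expR (weight R i * u ord0 ord0) - 1) * v ord0 i
   - (expR (weight R i * v ord0 ord0) - 1) * u ord0 i).
Proof.
rewrite /commg /conjg !(sol_mulE, sol_invE, sol_mul0, sol_inv0).
set w := weight R i; set a := u ord0 ord0; set b := v ord0 ord0.
rewrite !(mulrN, mulrDr, opprD) !(expRN, expRD, mulr1).
rewrite !(weight0, mul0r, expR0, invr1, mul1r).
have := lt0r_neq0 (expR_gt0 (w * a)); have := lt0r_neq0 (expR_gt0 (w * b)).
by move: (expR _) (expR _) => x y x0 y0; field; rewrite x0 y0.
Qed.

Definition nilradical : {pred G} := [pred u : G | u ord0 ord0 == 0].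

Lemma nilradical_closed : group_closed nilradical.
Proof.
split=> [|u v]; rewrite !inE ?sol_oneE//.
by move=> /eqP u0 /eqP v0; rewrite sol_mul0 sol_inv0 u0 v0 subrr.
Qed.

Lemma trivial_closed : group_closed (pred1 (1%g : G)).
Proof. by split=> [|u v]; rewrite !inE// => /eqP -> /eqP ->; rewrite divgg. Qed.

Lemma sol_solvable : solvable_group G.
Proof.
exists 2; rewrite /derived_series /=.
have D1 : commutator [set: G] [set: G] `<=` [set` nilradical].
  apply: gen_min nilradical_closed _ => _ [u _ [v _ <-]].
  by rewrite /= inE sol_commE weight0 !mul0r expR0 subrr !mul0r subrr mulr0.
apply/seteqP; split => [x|_ -> H _]; last exact: gpred1.
move=> xD2; apply/eqP; move: x xD2.
apply: gen_min trivial_closed _ => _ [u /D1/eqP uN [v /D1/eqP vN <-]].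
apply/eqP/rowP => i; rewrite sol_commE sol_oneE uN vN.
by rewrite !mulr0 expR0 subrr !mul0r subrr mulr0.
Qed.

Lemma sol_not_nilpotent : ~ nilpotent_group G.
Proof.
case=> k Gk1.
pose u : G := \row_i (i == 1)%:R.
(* The factor exp (ln 2) - 1 = 1 makes u reappear as its own commutator. *)
pose v : G := \row_i (- ln 2 * (i == 0)%:R).
have uv : [~ u, v]%g = u.
  apply/rowP => i; rewrite sol_commE !mxE /=.
  case: (eqVneq i 1) => [->|]; last by rewrite !(mulr0, mul0r, expR0, subrr).
  rewrite !(mulr0, mul0r, mulr1, mul1r, expR0, subrr, add0r).
  by rewrite opprK expRN lnK ?posrE//=; lra.
suff : u \in @lower_central_series G k.
  rewrite Gk1 inE => /rowP/(_ 1); rewrite !mxE eqxx => /eqP.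
  exact/negP/oner_neq0.
elim: k {Gk1} => [|k]; rewrite ?inE// => uk H Hcomm; rewrite -uv; apply: Hcomm.
by exists u => //; exists v.
Qed.

End sol_series.

(** * Invariant functions of a lattice *)

(** An invariant function descends to the compact space of cosets. *)
Lemma invariant_bounded (R : realType) (n : nat) (G : lieGroupType R n)
    (Gamma : groupClosed G) (h : G -> R) :
  is_lattice Gamma -> continuous h ->
  (forall x y, x \in Gamma -> h (x * y)%g = h y) ->
  exists M : R, forall x, `|h x| <= M.
Proof.
move=> [_ cptQ] hc hinv.
have hE (a b : G) : same_coset Gamma a b -> h a = h b.
  by move=> ab; rewrite -{1}(mulgVK b a) hinv.
pose pi : G -> coset_space Gamma := \pi_(coset_space Gamma).
have hpi : {homo h : a b / pi a == pi b >-> a == b}.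
  move=> a b /eqP ab; apply/eqP/hE.
  by apply/(@eqmodP _ (same_coset_equiv_rel Gamma)); exact: ab.
have hrc : continuous (h \o repr : coset_space Gamma -> R).
  exact: repr_comp_continuous.
have [M [Mr HM]] :=
  compact_bounded (continuous_compact (continuous_subspaceT hrc) cptQ).
exists (M + 1) => x.
have -> : h x = h (repr (pi x)).
  by apply/eqP/hpi; rewrite /pi reprK.
by apply: (HM (M + 1)); [rewrite ltrDl|exists (pi x)].
Qed.

(** * Discrete groups invariant under an unequal dilation *)

(** Dirichlet's approximation theorem: two of the Q + 1 fractional parts of
    0, x, ..., Q x lie in the same of the Q subintervals of length 1 / Q. *)
Lemma dirichlet (R : realType) (x : R) (Q : nat) : (0 < Q)%N ->
  exists p q : int, [/\ q != 0, `|q%:~R| <= Q%:R :> R &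
    `|p%:~R + q%:~R * x| < Q%:R^-1].
Proof.
move=> Q0; have Q0R : (0 : R) < Q%:R by rewrite ltr0n.
pose fr (y : R) := y - (Num.floor y)%:~R.
have fr01 y : 0 <= fr y < 1.
  have /andP[] := floor_itv y; rewrite intrD => ? ?.
  by rewrite /fr; apply/andP; split; lra.
have tr_lt (i : 'I_Q.+1) : (Num.truncn (Q%:R * fr (i%:R * x))%R < Q)%N.
  have /andP[fr0 fr1] := fr01 (i%:R * x).
  rewrite -(ltr_nat R); apply: (@le_lt_trans _ _ (Q%:R * fr (i%:R * x))%R).
    by rewrite truncn_le mulr_ge0// ltW.
  by rewrite gtr_pMr.
pose f (i : 'I_Q.+1) := Ordinal (tr_lt i).
have [i [j [ij fij]]] : exists i j : 'I_Q.+1, (i < j)%N /\ f i = f j.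
  have : ~~ injectiveb f.
    by apply/injectiveP => /leq_card; rewrite !card_ord ltnn.
  case/injectivePn => i [j ij fij].
  case: (ltngtP i j) => [lt|lt|/val_inj/eqP]; first by exists i, j.
    by exists j, i.
  by rewrite (negPf ij).
pose fl (i : 'I_Q.+1) := Num.floor (i%:R * x).
exists (fl i - fl j), (j%:Z - i%:Z).
have ji0 : 0 < (j%:R - i%:R : R) by rewrite subr_gt0 ltr_nat.
split.
- by rewrite subr_eq0 eq_sym; apply/eqP => -[] /eqP; rewrite ltn_eqF.
- rewrite intrB -!pmulrn gtr0_norm// lerBlDr -natrD ler_nat.
  by rewrite (leq_trans (_ : (j <= Q)%N)) ?leq_addr// -ltnS.
- have -> : (fl i - fl j)%:~R + (j%:Z - i%:Z)%:~R * x =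
      fr (j%:R * x) - fr (i%:R * x).
    rewrite /fr /fl !intrB -!pmulrn mulrBl.
    have swap (a b c d : R) : a - b + (c - d) = c - b - (d - a) by lra.
    exact: swap.
  have fr_itv k :
      (val (f k))%:R <= Q%:R * fr (k%:R * x) < (val (f k))%:R + 1.
    rewrite natr1; apply: truncn_itv.
    by have /andP[fr0 _] := fr01 (k%:R * x); rewrite mulr_ge0// ltW.
  have /andP[iQ Qi] := fr_itv i; have /andP[jQ Qj] := fr_itv j.
  rewrite -(ltr_pM2l Q0R) divff ?gt_eqF// -{1}(gtr0_norm Q0R) -normrM.
  by rewrite fij in iQ Qi; rewrite ltr_norml mulrBr; apply/andP; split; lra.
Qed.

Section dilation.
Variable R : realType.

Lemma weight_max : weight R ord_max = -2. Proof. by []. Qed.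

Lemma weight_cases (i : 'I_4) : [\/ i = ord0, weight R i = 1 | i = ord_max].
Proof.
case: i => [[|[|[|[|//]]]] lti].
- by apply: Or31; exact: val_inj.
- by apply: Or32.
- by apply: Or32.
- by apply: Or33; exact: val_inj.
Qed.

Lemma expRN_small (t e K : R) : 0 < t -> 0 < e ->
  exists n : nat, K * expR (- (n%:R * t)) < e.
Proof.
move=> t0 e0; pose n := (Num.truncn (`|K| / (e * t))).+1; exists n.
rewrite expRN ltr_pdivrMr ?expR_gt0//.
apply: le_lt_trans (ler_norm K) _.
have Kn : `|K| < e * (n%:R * t).
  rewrite mulrC -mulrA [t * e]mulrC -ltr_pdivrMr ?mulr_gt0//.
  exact: truncnS_gt.
apply: lt_le_trans Kn _; rewrite ler_pM2l//.
by apply: le_trans (expR_ge1Dx _); rewrite lerDr.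
Qed.

Implicit Types (v : 'rV[R]_4) (s : R).

(** The conjugation action of an element with t = s on R^3 (see [nil_conjE]). *)
Definition dil s v : 'rV[R]_4 := \row_i (expR (weight R i * s) * v ord0 i).

Lemma dil0 v : dil 0 v = v.
Proof. by apply/rowP => i; rewrite mxE mulr0 expR0 mul1r. Qed.

Lemma row_mulrz v (p : int) i : (v *~ p) ord0 i = p%:~R * v ord0 i.
Proof. by rewrite -scaler_int mxE. Qed.

Lemma dilD s t v : dil (s + t) v = dil s (dil t v).
Proof. by apply/rowP => i; rewrite !mxE mulrDr expRD mulrA. Qed.

(** L stands for the intersection of the lattice with R^3, t for the coordinate
    t of a lattice element, and the cube of size e isolates 0 in L. *)
Variables (L : set 'rV[R]_4) (t e : R).
Hypothesis L0 : L 0.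
Hypothesis LB : forall u v, L u -> L v -> L (u - v).
Hypothesis Ldil : forall v, L v -> L (dil t v).
Hypothesis LdilN : forall v, L v -> L (dil (- t) v).
Hypothesis t0 : 0 < t.
Hypothesis e0 : 0 < e.
Hypothesis Le : forall v, L v -> (forall i, `|v ord0 i| < e) -> v = 0.
Hypothesis L_ord0 : forall v, L v -> v ord0 ord0 = 0.

Lemma L_mulz v (p : int) : L v -> L (v *~ p).
Proof.
move=> Lv.
have LN u : L u -> L (- u) by move=> /(LB L0); rewrite sub0r.
have Ln n : L (v *+ n).
  elim: n => [|n IHn]//; rewrite mulrS -[v *+ n]opprK.
  by apply: LB => //; exact: LN.
by case: p => n; [exact: Ln|exact/LN/Ln].
Qed.

Lemma L_dil_natl n v : L v -> L (dil (n%:R * t) v) /\ L (dil (- (n%:R * t)) v).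
Proof.
elim: n v => [|n IHn] v Lv; first by rewrite mul0r oppr0 dil0.
rewrite -natr1 mulrDl mul1r opprD !dilD.
by split; [apply: (IHn _ _).1; exact: Ldil|apply: (IHn _ _).2; exact: LdilN].
Qed.

Lemma dil_eq0 s v : dil s v = 0 -> v = 0.
Proof.
move=> dv; rewrite -[v]dil0 -(addNr s) dilD dv.
by apply/rowP => i; rewrite !mxE mulr0.
Qed.

(** Such vectors are contracted by the inverse of the action. *)
Lemma dil_discrete_weight1 v : L v -> v ord0 ord_max = 0 -> v = 0.
Proof.
move=> Lv vmax.
have [n nP] := expRN_small (\sum_i `|v ord0 i|) t0 e0.
apply/(@dil_eq0 (- (n%:R * t)))/Le => [|i]; first exact: (L_dil_natl n Lv).2.
rewrite mxE; case: (weight_cases i) => [->|w1|->].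
- by rewrite L_ord0// mulr0 normr0.
- rewrite w1 mul1r normrM gtr0_norm ?expR_gt0// mulrC.
  apply: le_lt_trans nP; rewrite ler_pM2r ?expR_gt0//.
  by rewrite (bigD1 i)//= lerDl sumr_ge0.
- by rewrite vmax mulr0 normr0.
Qed.

(** Such vectors are contracted by the action itself. *)
Lemma dil_discrete_weightN2 v : L v ->
  (forall i, weight R i = 1 -> v ord0 i = 0) -> v = 0.
Proof.
move=> Lv v1.
have [n nP] := expRN_small `|v ord0 ord_max| t0 e0.
apply/(@dil_eq0 (n%:R * t))/Le => [|i]; first exact: (L_dil_natl n Lv).1.
rewrite mxE; case: (weight_cases i) => [->|w1|->].
- by rewrite L_ord0// mulr0 normr0.
- by rewrite v1// mulr0 normr0.
- rewrite weight_max normrM gtr0_norm ?expR_gt0// mulrC.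
  apply: le_lt_trans nP; apply: ler_wpM2l => //.
  have : 0 <= n%:R * t by rewrite mulr_ge0// ltW.
  by rewrite ler_expR; move: (n%:R * t) => x x0; lra.
Qed.

(** With mu = exp t, nu = mu^-2 and E = mu^n, the vector
    u = p (dil (n t) v) + q (dil ((n + 1) t) v) has the coordinates
    E (p + q mu) v_i in weight 1 and E^-2 (p + q nu) v_3 in weight -2. For the
    Dirichlet approximation p + q mu = O(1/Q), these are O(E / Q) and
    O(Q / E^2). As the product of the two orders is 1 / E, both can be made
    small at once, by taking Q as a large multiple of E; and u <> 0, since
    mu <> nu prevents p + q mu and p + q nu from vanishing together. *)
Lemma dil_discrete v : L v -> v = 0.
Proof.
move=> Lv.
have [|vmax] := eqVneq (v ord0 ord_max) 0; first exact: dil_discrete_weight1.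
have [v1|] := pselect (forall i, weight R i = 1 -> v ord0 i = 0).
  exact: dil_discrete_weightN2.
move=> /existsNP[j /not_implyP[wj /eqP vj]].
pose C := 1 + \sum_i `|v ord0 i|.
have vC i : `|v ord0 i| <= C.
  by rewrite /C (bigD1 i)//= addrCA lerDl addr_ge0 ?sumr_ge0.
have C0 : 0 < C by rewrite ltr_pwDl ?sumr_ge0.
pose mu := expR t; have mu0 : 0 < mu by exact: expR_gt0.
pose nu := expR (-2 * t); have nu0 : 0 < nu by exact: expR_gt0.
have numu : nu < mu.
  by rewrite ltr_expR; apply: lt_trans t0; rewrite mulNr oppr_lt0 mulr_gt0.
(* The constant bounds E times the coordinate of weight -2, given that
   Q <= C E / e + 1. *)
have [n nP] := expRN_small ((1 + mu + C * mu / e) * C) t0 e0.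
pose E := expR (n%:R * t); have E0 : 0 < E by exact: expR_gt0.
have E1 : 1 <= E by rewrite -expR0 ler_expR mulr_ge0// ltW.
pose Q := (Num.truncn (C * E / e)).+1.
have QE : C * E / e < Q%:R by exact: truncnS_gt.
have EQ : Q%:R <= C * E / e + 1.
  by rewrite -natr1 lerD2r truncn_le mulr_ge0 ?invr_ge0 ?mulr_ge0// ltW.
have Q0 : 0 < Q%:R :> R by rewrite ltr0n.
have [p [q [q0 qQ pq]]] := dirichlet mu (isT : (0 < Q)%N).
pose u := dil (n%:R * t) v *~ p + dil (n.+1%:R * t) v *~ q.
have Lu : L u.
  rewrite /u -[dil (n.+1%:R * t) v *~ q]opprK -mulrNz; apply: LB.
    by apply: L_mulz; exact: (L_dil_natl n Lv).1.
  by apply: L_mulz; exact: (L_dil_natl n.+1 Lv).1.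
have uE i : u ord0 i = expR (weight R i * (n%:R * t)) *
    ((p%:~R + q%:~R * expR (weight R i * t)) * v ord0 i).
  rewrite mxE !row_mulrz !mxE -natr1 mulrDl mul1r.
  rewrite [weight R i * (_ + t)]mulrDr expRD.
  move: (expR _) (expR (weight R i * t)) (v ord0 i) (p%:~R) (q%:~R).
  by move=> a b c p' q'; ring.
have u0 : u = 0.
  apply: Le => // i; rewrite uE; case: (weight_cases i) => [->|->|->].
  - by rewrite L_ord0// !mulr0 normr0.
  - rewrite !mul1r -/E -/mu normrM gtr0_norm// normrM.
    apply: (@le_lt_trans _ _ (E * (Q%:R^-1 * C))).
      by rewrite ler_pM2l// ler_pM// ltW.
    by rewrite mulrCA ltr_pdivrMl// [E * C]mulrC -ltr_pdivrMr.
  - rewrite weight_max -/nu normrM normrM gtr0_norm ?expR_gt0//.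
    have pqnu : `|p%:~R + q%:~R * nu| <= 1 + Q%:R * mu.
      have -> : p%:~R + q%:~R * nu =
          (p%:~R + q%:~R * mu) - q%:~R * (mu - nu) by ring.
      apply: le_trans (ler_normB _ _) _; apply: lerD.
        by apply: le_trans (ltW pq) _; rewrite invf_le1// ler1n.
      rewrite normrM; apply: ler_pM => //.
      by rewrite gtr0_norm ?subr_gt0// lerBlDr lerDl ltW.
    apply: le_lt_trans nP.
    have -> : expR (-2 * (n%:R * t)) = E^-1 * E^-1.
      by rewrite /E -expRN -expRD; congr expR; ring.
    rewrite expRN -/E [leRHS]mulrC -[leLHS]mulrA ler_pM2l ?invr_gt0//.
    rewrite mulrC ler_pdivrMr//.
    have pqC : `|p%:~R + q%:~R * nu| * `|v ord0 ord_max| <=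
        (1 + Q%:R * mu) * C by exact: ler_pM.
    apply: le_trans pqC _; rewrite mulrAC ler_pM2r//.
    apply: (@le_trans _ _ (1 + (C * E / e + 1) * mu)).
      by rewrite lerD2l ler_pM2r.
    have -> : (1 + mu + C * mu / e) * E = E + mu * E + C * E / e * mu by ring.
    rewrite mulrDl mul1r [_ * mu + mu]addrC addrA lerD2r lerD//.
    by rewrite ler_peMr// ltW.
have /eqP := congr1 (fun w : 'rV_4 => w ord0 j) u0.
rewrite uE mxE wj !mul1r mulf_eq0 gt_eqF//= mulf_eq0 (negPf vj).
rewrite orbF => /eqP pq1.
have /eqP := congr1 (fun w : 'rV_4 => w ord0 ord_max) u0.
rewrite uE mxE weight_max mulf_eq0 gt_eqF ?expR_gt0//= mulf_eq0 (negPf vmax).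
rewrite orbF => /eqP pq2.
have : q%:~R * (mu - nu) = 0 :> R.
  have -> : q%:~R * (mu - nu) =
      (p%:~R + q%:~R * mu) - (p%:~R + q%:~R * nu) by ring.
  by rewrite pq1 pq2 subrr.
by move=> /eqP; rewrite mulf_eq0 intr_eq0 (negPf q0) subr_eq0 gt_eqF.
Qed.

End dilation.

(** * Absence of lattices *)

Section no_lattice.
Variable R : realType.
Local Notation G := (sol4 R).
Implicit Types u v : G.
Variable Gamma : groupClosed G.
Hypothesis latticeG : is_lattice Gamma.

Definition lattice_nil : set 'rV[R]_4 :=
  [set v | (v : G) \in Gamma /\ v ord0 ord0 = 0].

Lemma nil_divE u v : u ord0 ord0 = 0 -> v ord0 ord0 = 0 ->
  (u / v)%g = (u : 'rV_4) - (v : 'rV_4).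
Proof.
move=> u0 v0; apply/rowP => i.
by rewrite sol_mulE sol_invE u0 v0 mulr0 oppr0 expR0 !mul1r !mxE.
Qed.

Lemma nil_conjE u v : v ord0 ord0 = 0 -> (u * v / u)%g = dil (u ord0 ord0) v.
Proof.
move=> v0; apply/rowP => i.
rewrite sol_mulE sol_invE sol_mul0 sol_mulE v0 addr0 mxE.
by rewrite mulrN mulrA expRxMexpNx_1 mul1r addrAC subrr add0r.
Qed.

Lemma lattice_nilB u v : lattice_nil u -> lattice_nil v ->
  lattice_nil ((u : 'rV_4) - (v : 'rV_4)).
Proof.
move=> [uG u0] [vG v0]; rewrite -nil_divE//; split; first exact: gpredF.
by rewrite sol_mul0 sol_inv0 u0 v0 subrr.
Qed.

Lemma lattice_nil_dil u v : u \in Gamma -> lattice_nil v ->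
  lattice_nil (dil (u ord0 ord0) v).
Proof.
move=> uG [vG v0]; rewrite -nil_conjE//; split.
  by rewrite gpredF// gpredM.
by rewrite !(sol_mul0, sol_inv0) v0 addr0 subrr.
Qed.

Lemma lattice_isolated1 : exists2 e : R, 0 < e &
  forall v, v \in Gamma -> (forall i, `|v ord0 i| < e) -> v = 1%g.
Proof.
have [/(_ 1%g (gpred1 (s := Gamma)))[_ [V V1 VG]] _] := latticeG.
have /nbhs_ballP[e e0 eV] := V1.
exists e => // v vG ve; have : (V `&` [set` Gamma]) v; last by rewrite VG.
split=> //; apply: eV; split=> // i j.
by rewrite !(ord1 i) mxE /ball/= sub0r normrN.
Qed.

Lemma coord_fun_continuous (i : 'I_4) : continuous (fun v : G => v ord0 i : R).
Proof. exact: coord_continuous. Qed.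

(** Otherwise the coordinate t is an unbounded invariant function. *)
Lemma lattice_shift : exists2 u, u \in Gamma & 0 < u ord0 ord0.
Proof.
suff [u uG u0] : exists2 u, u \in Gamma & u ord0 ord0 != 0.
  have [u_gt0|u_le0] := ltP 0 (u ord0 ord0); first by exists u.
  by exists u^-1%g; rewrite ?gpredV// sol_inv0 oppr_gt0 lt_neqAle u0.
apply: contrapT => H.
have [|M HM] := invariant_bounded latticeG (@coord_fun_continuous ord0).
  move=> u v uG; rewrite sol_mul0; suff -> : u ord0 ord0 = 0 by rewrite add0r.
  by apply/eqP; apply: contrapT => /negP u0; apply: H; exists u.
have := HM (const_mx (`|M| + 1)); rewrite mxE ger0_norm ?addr_ge0//.
by rewrite leNgt => /negP; apply; rewrite ltr_pwDr// ler_norm.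
Qed.

Lemma lattice_nil_eq0 v : lattice_nil v -> v = 0 :> 'rV_4.
Proof.
have [u uG u0] := lattice_shift; have [e e0 He] := lattice_isolated1.
apply: (@dil_discrete _ _ (u ord0 ord0) e) => //.
- by split; [exact: gpred1|rewrite mxE].
- exact: lattice_nilB.
- by move=> w; exact: lattice_nil_dil.
- by move=> w; rewrite -sol_inv0; apply: lattice_nil_dil; rewrite gpredV.
- by move=> w [wG _]; exact: He.
- by move=> w [].
Qed.

(** All commutators of u with Gamma are trivial, so every v in Gamma fixes, in
    the first coordinate, the fixed point c of u. *)
Lemma sol_no_lattice : False.
Proof.
have [u uG u0] := lattice_shift.
have comm v : v \in Gamma -> [~ u, v]%g = 1%g.
  move=> vG; apply: lattice_nil_eq0; split.
    by rewrite /commg /conjg !gpredM ?gpredV.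
  by rewrite sol_commE weight0 !mul0r expR0 subrr !mul0r subrr mulr0.
pose i : 'I_4 := 1.
pose x0 (v : G) : R := v ord0 ord0; pose x1 (v : G) : R := v ord0 i.
have w1 : weight R i = 1 by [].
have d0 : 1 - expR (x0 u) != 0 by rewrite subr_eq0 lt_eqF// expR_gt1.
pose c := x1 u / (1 - expR (x0 u)).
have fix_c v : v \in Gamma -> x1 v + expR (x0 v) * c = c.
  move=> /comm/rowP/(_ i); rewrite sol_commE sol_oneE w1 !mul1r => /eqP.
  rewrite mulf_eq0 gt_eqF ?expR_gt0//= subr_eq0.
  rewrite -/(x0 u) -/(x0 v) -/(x1 u) -/(x1 v) => /eqP uv.
  apply: (mulIf d0); rewrite /c mulrDl !mulrA !divfK//.
  have -> : x1 v * (1 - expR (x0 u)) = - ((expR (x0 u) - 1) * x1 v) by ring.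
  by rewrite uv; ring.
pose h v := (x1 v - c) * expR (- x0 v).
have hc : continuous h.
  move=> v.
  apply: (@cvgM _ G (nbhs v) _ (fun v => x1 v - c) (fun v => expR (- x0 v))).
    by apply: cvgB; [exact: coord_fun_continuous|exact: cvg_cst].
  apply: (@continuous_comp _ _ _ (fun v => - x0 v) expR).
    exact: cvgN (@coord_fun_continuous ord0 v).
  exact: continuous_expR.
have hinv v w : v \in Gamma -> h (v * w)%g = h w.
  move=> vG; have x1M : x1 (v * w)%g - c = expR (x0 v) * (x1 w - c).
    rewrite /x1 sol_mulE w1 mul1r -/(x1 v) -/(x1 w) -/(x0 v).
    by rewrite -{1}(fix_c v vG); ring.
  have x0M : x0 (v * w)%g = x0 v + x0 w by exact: sol_mul0.
  by rewrite /h x1M x0M opprD expRD mulrACA expRxMexpNx_1 mul1r.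
have [M HM] := invariant_bounded latticeG hc hinv.
pose w : G := \row_j ((c + (`|M| + 1)) * (j == i)%:R).
have := HM w; rewrite /h /x1 /x0 !mxE eqxx mulr1 mulr0 oppr0 expR0 mulr1.
rewrite [c + _]addrC addrK ger0_norm ?addr_ge0// leNgt => /negP; apply.
by rewrite ltr_pwDr// ler_norm.
Qed.

End no_lattice.

(** * Haar measure *)

Section scaling.
Context {R : realType}.

Definition scales d (T : measurableType d) (m : {measure set T -> \bar R})
    (c : R) (f : T -> T) : Prop :=
  [/\ 0 < c, measurable_fun setT f &
      forall A, measurable A -> m (f @^-1` A) = (c%:E * m A)%E].

(** Tonelli: at x, the fibre of the preimage is the preimage of the fibre at
    f x, so each variable contributes its own factor. *)
Lemma scales_skew_product d1 d2
    (T1 : measurableType d1) (T2 : measurableType d2)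
    (m1 : {measure set T1 -> \bar R})
    (m2 : {sigma_finite_measure set T2 -> \bar R}) c1 c2
    (f : T1 -> T1) (g : T1 * T2 -> T2) :
  scales m1 c1 f -> measurable_fun setT g ->
  (forall x, scales m2 c2 (fun y => g (x, y))) ->
  scales (m1 \x m2)%E (c1 * c2) (fun z => (f z.1, g z)).
Proof.
move=> [c1_gt0 mf fE] mg gE; have [c2_gt0 _ _] := gE point.
split; first exact: mulr_gt0.
  by apply: measurable_fun_pair => //; exact: measurableT_comp.
move=> A mA; rewrite /product_measure1.
pose phi : T1 -> \bar R := m2 \o xsection A.
have mphi : measurable_fun setT phi by exact: measurable_fun_xsection.
transitivity (\int[m1]_x (c2%:E * (phi \o f) x))%E.
  apply: eq_integral => x _ /=; have [_ _ <-] := gE x.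
    by congr (m2 _); apply/seteqP; split => y /=; rewrite /xsection/= !inE.
  exact: measurable_xsection.
rewrite ge0_integralZl//; [|exact: measurableT_comp|by rewrite lee_fin ltW].
rewrite [c1 * c2]mulrC EFinM -muleA; congr (_ * _)%E.
transitivity (\int[pushforward m1 f]_x phi x)%E.
  by rewrite (ge0_integral_pushforward mf).
pose c := NngNum (ltW c1_gt0).
rewrite -[c1]/(c%:num) -ge0_integral_mscale//.
by apply: eq_measure_integral => B mB _; exact: fE.
Qed.

Lemma scales_affine (a b : R) : 0 < a ->
  scales lebesgue_measure a^-1 (fun x : measurableTypeR R => b + a * x).
Proof.
move=> a0; set f : measurableTypeR R -> measurableTypeR R := (fun x => _).
have mf : measurable_fun setT f.
  by apply: measurable_funD => //; exact: measurable_funM.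
split=> //; first by rewrite invr_gt0.
pose c := NngNum (ltW a0).
pose m : {measure set (measurableTypeR R) -> \bar R} :=
  measure_function_pushforward__canonical__measure_function_Measure
    lebesgue_measure mf.
have mE : forall A, measurable A -> lebesgue_measure A = mscale c m A.
  apply: lebesgue_measure_unique => _ [[p q] _ <-].
  rewrite -[RHS]/(a%:E * lebesgue_measure (f @^-1` `]p, q]))%E.
  have -> : f @^-1` `]p, q]%classic = `]((p - b) / a), ((q - b) / a)]%classic.
    apply/seteqP; split => x /=;
      rewrite /f !in_itv/= ltr_pdivrMr// ler_pdivlMr//;
      by rewrite ltrBlDl lerBrDl [x * a]mulrC.
  rewrite !lebesgue_measure_itv/= !lte_fin ltr_pM2r ?invr_gt0// ltrD2r.
  case: ifPn => _; last by rewrite mule0.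
  by rewrite -!EFinB -EFinM; congr (_%:E); field; rewrite gt_eqF.
move=> A mA; transitivity (a^-1%:E * (a%:E * lebesgue_measure (f @^-1` A)))%E.
  by rewrite muleA -EFinM mulVf ?gt_eqF// mul1e.
by congr (_ * _)%E; exact/esym/mE.
Qed.

End scaling.

Section sigma_finite_product.
Context d1 d2 (T1 : measurableType d1) (T2 : measurableType d2) (R : realType).
Variables (m1 : {sigma_finite_measure set T1 -> \bar R}).
Variables (m2 : {sigma_finite_measure set T2 -> \bar R}).

(** An alias of the product measure that carries the sigma-finite structure,
    so that products can be iterated. *)
Definition sigma_finite_product : set (T1 * T2) -> \bar R := (m1 \x m2)%E.

HB.instance Definition _ := Measure.copy sigma_finite_product
  ((m1 \x m2)%E : measure (T1 * T2)%type R).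

Lemma sigma_finite_product_setT : sigma_finite setT sigma_finite_product.
Proof.
have /sigma_finiteP[F [TF ndF Foo]] := sigma_finiteT m1.
have /sigma_finiteP[G [TG ndG Goo]] := sigma_finiteT m2.
exists (fun n => F n `*` G n).
  apply/esym/seteqP; split => // -[x y] _.
  have [n _ Fnx] : (\bigcup_i F i) x by rewrite -TF.
  have [k _ Gky] : (\bigcup_i G i) y by rewrite -TG.
  have /subsetPset Fm := ndF _ _ (leq_maxl n k).
  have /subsetPset Gm := ndG _ _ (leq_maxr n k).
  by exists (maxn n k) => //; split; [exact: Fm|exact: Gm].
move=> k; have [mF Fk] := Foo k; have [mG Gk] := Goo k.
split; first exact: measurableX.
rewrite /sigma_finite_product product_measure1E// lte_mul_pinfty//.
by rewrite ge0_fin_numE.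
Qed.

HB.instance Definition _ := Measure_isSigmaFinite.Build _ _ _
  sigma_finite_product sigma_finite_product_setT.

End sigma_finite_product.

Lemma ord4_ind (P : 'I_4 -> Prop) : P 0 -> P 1 -> P 2 -> P 3 -> forall i, P i.
Proof.
move=> P0 P1 P2 P3 [[|[|[|[|//]]]] lti].
- by rewrite (_ : Ordinal lti = 0)//; exact: val_inj.
- by rewrite (_ : Ordinal lti = 1)//; exact: val_inj.
- by rewrite (_ : Ordinal lti = 2)//; exact: val_inj.
- by rewrite (_ : Ordinal lti = 3)//; exact: val_inj.
Qed.

Section haar.
Context {R : realType}.
Local Notation M := (measurableTypeR R).
Local Notation lam := (@lebesgue_measure R).
Local Notation G := (sol4 R).
Local Notation borel := (g_sigma_algebraType (@open G)).

Definition volume2 : {sigma_finite_measure set (M * M)%type -> \bar R} :=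
  sigma_finite_product lam lam.
Definition volume3 : {sigma_finite_measure set (M * (M * M))%type -> \bar R} :=
  sigma_finite_product lam volume2.
Definition volume4 :
    {sigma_finite_measure set (M * (M * (M * M)))%type -> \bar R} :=
  sigma_finite_product lam volume3.

(** The common form of left and right translations of G: the shift of each
    coordinate depends on the first one, and the scaling factors are constant.
    The factor 1 gives all four coordinates the form of [scales_affine]. *)
Definition triangular (s a1 a2 a3 : R) (w1 w2 w3 : M -> R)
    (z : M * (M * (M * M))) : M * (M * (M * M)) :=
  (s + 1 * z.1, (w1 z.1 + a1 * z.2.1,
    (w2 z.1 + a2 * z.2.2.1, w3 z.1 + a3 * z.2.2.2))).

Lemma scales_triangular s a1 a2 a3 w1 w2 w3 :
  0 < a1 -> 0 < a2 -> 0 < a3 ->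
  measurable_fun setT w1 -> measurable_fun setT w2 -> measurable_fun setT w3 ->
  scales volume4 (1^-1 * (a1^-1 * (a2^-1 * a3^-1)))
    (triangular s a1 a2 a3 w1 w2 w3).
Proof.
move=> a1_gt0 a2_gt0 a3_gt0 mw1 mw2 mw3.
have maff d (T : measurableType d) (w h : T -> R) (a : R) :
    measurable_fun setT w -> measurable_fun setT h ->
    measurable_fun setT (fun z => w z + a * h z).
  by move=> mw mh; apply: measurable_funD => //; exact: measurable_funM.
apply: (@scales_skew_product R _ _ M _ lam volume3 _ _ (fun t => s + 1 * t)
  (fun z => (w1 z.1 + a1 * z.2.1,
    (w2 z.1 + a2 * z.2.2.1, w3 z.1 + a3 * z.2.2.2)))).
- exact: scales_affine.
- apply: measurable_fun_pair.
    by apply: maff; exact: measurableT_comp.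
  by apply: measurable_fun_pair; apply: maff; do ?exact: measurableT_comp;
    apply: measurableT_comp => //; exact: measurableT_comp.
move=> x; apply: (@scales_skew_product R _ _ M _ lam volume2 _ _
  (fun t => w1 x + a1 * t) (fun z => (w2 x + a2 * z.2.1, w3 x + a3 * z.2.2))).
- exact: scales_affine.
- by apply: measurable_fun_pair; apply: maff => //; exact: measurableT_comp.
move=> y; apply: (@scales_skew_product R _ _ M _ lam lam _ _
  (fun t => w2 x + a2 * t) (fun z => w3 x + a3 * z.2)).
- exact: scales_affine.
- exact: maff.
- by move=> z; exact: scales_affine.
Qed.

Definition to_sol (z : M * (M * (M * M))) : borel :=
  (\row_i [:: z.1; z.2.1; z.2.2.1; z.2.2.2]`_i : 'rV[R]_4) : G.

Lemma to_sol_ball (x : 'rV[R]_4) (r : R) : 0 < r ->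
  to_sol @^-1` (ball x r) =
  ball (x ord0 0) r `*` (ball (x ord0 1) r `*`
    (ball (x ord0 2) r `*` ball (x ord0 3) r)).
Proof.
move=> r0; apply/seteqP; split => -[a [b [c d]]] /=.
  move=> [_ H]; do !split.
  - by have := H ord0 0; rewrite mxE.
  - by have := H ord0 1; rewrite mxE.
  - by have := H ord0 2; rewrite mxE.
  - by have := H ord0 3; rewrite mxE.
move=> [Ha [Hb [Hc Hd]]]; split=> // i j; rewrite (ord1 i) mxE.
by elim/ord4_ind: j.
Qed.

Lemma measurable_to_sol_ball (x : 'rV[R]_4) (r : R) : 0 < r ->
  measurable (to_sol @^-1` (ball x r)).
Proof.
move=> r0; rewrite to_sol_ball//.
by do 3?apply: measurableX; exact: measurable_ball.
Qed.

Lemma volume4X (A B C D : set M) :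
  measurable A -> measurable B -> measurable C -> measurable D ->
  volume4 (A `*` (B `*` (C `*` D))) = (lam A * (lam B * (lam C * lam D)))%E.
Proof.
move=> mA mB mC mD.
have E2 : volume2 (C `*` D) = (lam C * lam D)%E by exact: product_measure1E.
have E3 : volume3 (B `*` (C `*` D)) = (lam B * volume2 (C `*` D))%E.
  by apply: product_measure1E => //; exact: measurableX.
rewrite -E2 -E3; apply: product_measure1E => //.
by do 2?apply: measurableX.
Qed.

Lemma volume4_ball (x : 'rV[R]_4) (r : R) : 0 < r ->
  volume4 (to_sol @^-1` (ball x r)) = ((r *+ 2) ^+ 4)%:E.
Proof.
move=> r0; rewrite to_sol_ball// volume4X; try exact: measurable_ball.
by rewrite !lebesgue_measure_ball ?ltW// -!EFinM !exprS expr0 mulr1.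
Qed.

(** An open set is a countable union of cubes. *)
Lemma measurable_to_sol : measurable_fun setT to_sol.
Proof.
apply: (@measurability _ _ (M * (M * (M * M)))%type borel setT to_sol
  (@open G)) => //.
move=> _ [U oU <-]; rewrite setTI.
have -> : U = \bigcup_(p in [set p | @rat_ball R 4 p `<=` U]) rat_ball p.
  apply/seteqP; split => [x Ux|x [p pU px]]; last exact: pU.
  have [_ /(_ x)] := @rat_ball_basis R 4.
  move=> /(_ U (open_nbhs_nbhs (conj oU Ux))) [V [[p _ <-] px] pU].
  by exists p.
rewrite preimage_bigcup bigcup_mkcond; apply: countable_bigcupT_measurable.
  exact: countableP.
by move=> p; case: ifP => // _; exact: measurable_to_sol_ball.
Qed.

Definition haar : {measure set borel -> \bar R} :=
  measure_function_pushforward__canonical__measure_function_Measure volume4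
    measurable_to_sol.

Lemma haar_preimage (h : G -> G) (A : set borel) s a1 a2 a3 w1 w2 w3 :
  0 < a1 -> 0 < a2 -> 0 < a3 -> a1 * (a2 * a3) = 1 ->
  measurable_fun setT w1 -> measurable_fun setT w2 -> measurable_fun setT w3 ->
  (forall z, h (to_sol z) = to_sol (triangular s a1 a2 a3 w1 w2 w3 z)) ->
  measurable A -> haar (h @^-1` A) = haar A.
Proof.
move=> a1_gt0 a2_gt0 a3_gt0 a123 mw1 mw2 mw3 hE mA.
have mtA : measurable (to_sol @^-1` A).
  by rewrite -[X in measurable X]setTI; exact: measurable_to_sol.
rewrite -[LHS]/(volume4 ((fun z => h (to_sol z)) @^-1` A)).
rewrite (_ : (fun z => _) = to_sol \o triangular s a1 a2 a3 w1 w2 w3);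
  last exact/funext.
have [_ _ /(_ _ mtA)] := scales_triangular s a1_gt0 a2_gt0 a3_gt0 mw1 mw2 mw3.
by rewrite -!invfM a123 mulr1 invr1 mul1e.
Qed.

(** The scaling factors have product 1 because the weights have sum 0. *)
Lemma haar_left_invariant : left_invariant haar.
Proof.
move=> g A mA; set h := (g^-1)%g.
rewrite (_ : [set _ | x in _] = (fun x : G => (h * x)%g) @^-1` A); last first.
  apply/seteqP; split => [_ [x Ax <-]|x Ahx] /=; first by rewrite mulKg.
  by exists (h * x)%g; rewrite ?mulVKg.
move: {g}h => h; pose a (i : 'I_4) := expR (weight R i * h ord0 ord0).
apply: (@haar_preimage _ _ (h ord0 ord0) (a 1) (a 2) (a 3)
  (cst (h ord0 1)) (cst (h ord0 2)) (cst (h ord0 3))); rewrite ?expR_gt0//.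
  rewrite /a -!expRD -!mulrDl (_ : _ + _ = 0) ?mul0r ?expR0//.
  by rewrite /weight/=; lra.
move=> z; apply/rowP => i; rewrite sol_mulE; elim/ord4_ind: i; rewrite !mxE//=.
by rewrite -[weight R 0]/(0 : R) mul0r expR0.
Qed.

(** A right translation shifts R^3 by a vector that depends on t only. *)
Lemma haar_right_invariant : right_invariant haar.
Proof.
move=> g A mA; set h := (g^-1)%g.
rewrite (_ : [set _ | x in _] = (fun x : G => (x * h)%g) @^-1` A); last first.
  apply/seteqP; split => [_ [x Ax <-]|x Ahx] /=; first by rewrite mulgK.
  by exists (x * h)%g; rewrite ?mulgVK ?mulgKV.
move: {g}h => h.
pose w (i : 'I_4) (t : M) : R := expR (weight R i * t) * h ord0 i.
have mw i : measurable_fun setT (w i).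
  apply: (@measurable_funM _ _ _ _ (fun t => expR (weight R i * t))
    (cst (h ord0 i))) => //.
  by apply: measurableT_comp => //; exact: measurable_funM.
apply: (@haar_preimage _ _ (h ord0 ord0) 1 1 1 (w 1) (w 2) (w 3)) => //.
  by rewrite !mulr1.
move=> z; apply/rowP => i; rewrite sol_mulE.
elim/ord4_ind: i; rewrite !mxE/= ?mul1r.
- by rewrite -[weight R 0]/(0 : R) mul0r expR0 mul1r addrC.
- by rewrite [LHS]addrC /w mul1r.
- by rewrite [LHS]addrC /w mul1r.
- by rewrite [LHS]addrC.
Qed.

Lemma open_measurable_borel (U : set G) : open U -> measurable (U : set borel).
Proof. by move=> oU; exact: sub_sigma_algebra. Qed.

Lemma haar_ball (x : 'rV[R]_4) (r : R) : 0 < r ->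
  haar (ball x r) = ((r *+ 2) ^+ 4)%:E.
Proof. exact: volume4_ball. Qed.

Lemma measurable_ball_borel (x : 'rV[R]_4) (r : R) :
  measurable (ball x r : set borel).
Proof. by apply: open_measurable_borel; exact: (@ball_open _ 'rV[R]_4). Qed.

Lemma sol_unimodular : unimodular G.
Proof.
exists haar; split; last exact: haar_right_invariant.
split=> [|K cK|U oU [x Ux]]; first exact: haar_left_invariant.
- have [r [r0 Kr]] : exists r : R, 0 < r /\ K `<=` ball (0 : 'rV[R]_4) r.
    have [N [_ HN]] := @compact_bounded R 'rV[R]_4 K cK.
    exists (`|N| + 2); split; first by rewrite ltr_wpDl.
    move=> y Ky; rewrite mx_norm_ball /ball_/= sub0r normrN.
    apply: le_lt_trans (HN (`|N| + 1) _ y Ky) _; last by rewrite ltrD2l ltr1n.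
    by rewrite ltr_pwDr// ler_norm.
  have mK : measurable (K : set borel).
    rewrite -[K]setCK; apply: measurableC; apply: open_measurable_borel.
    by apply: closed_openC; apply: compact_closed => //; exact: sol_hausdorff.
  apply: (@le_lt_trans _ _ (haar (ball (0 : 'rV[R]_4) r))).
    by apply: le_measure; rewrite ?inE//; exact: measurable_ball_borel.
  by rewrite haar_ball// ltry.
- have [r r0 rU] : exists2 r : R, 0 < r & ball (x : 'rV[R]_4) r `<=` U.
    by have /nbhs_ballP[r r0 rU] := open_nbhs_nbhs (conj oU Ux); exists r.
  apply: (@lt_le_trans _ _ (haar (ball (x : 'rV[R]_4) r))).
    by rewrite haar_ball// lte_fin exprn_gt0// mulrn_wgt0.
  apply: le_measure; rewrite ?inE//; first exact: measurable_ball_borel.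
  exact: open_measurable_borel.
Qed.

End haar.

Theorem mainTheorem4 (R : realType) :
  exists G : lieGroupType R 4,
    [/\ simply_connected R G, unimodular G, solvable_group G,
        ~ nilpotent_group G &
        forall Gamma : groupClosed G, ~ is_lattice Gamma].
Proof.
exists (sol4 R); split.
- exact: sol_simply_connected.
- exact: sol_unimodular.
- exact: sol_solvable.
- exact: sol_not_nilpotent.
- by move=> Gamma; exact: sol_no_lattice.
Qed.
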